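(* Let $R=\bigoplus_{\alpha\in\Gamma}R_\alpha$ be a graded integral domain. The space $\mathrm{HStar}_f(R)$ of finite type homogeneous star operations on $R$, endowed with the Zariski topology, is a spectral space.
   Context: $\Gamma$ is a nonzero torsionless commutative cancellative monoid (torsionless means its quotient group $\langle\Gamma\rangle$ is torsion-free), $R=\bigoplus_{\alpha\in\Gamma}R_\alpha$ is an integral domain graded by $\Gamma$ with quotient field $K$, $H$ is the set of nonzero homogeneous elements of $R$, and $R_H$ is the localization, a $\langle\Gamma\rangle$-graded domain. An ideal $I$ of $R$ is homogeneous if $I=\bigoplus_\alpha (I\cap R_\alpha)$; a fractional ideal $A$ of $R$ is homogeneous if $sA$ is a homogeneous ideal of $R$ for some $s\in H$. $\mathbf{HF}(R)$ is the set of nonzero homogeneous fractional ideals. A homogeneous star operation on $R$ is a map $*:\mathbf{HF}(R)\to\mathbf{HF}(R)$ such that for all nonzero homogeneous $x\in R_H$ and $A,B\in\mathbf{HF}(R)$: $(x)^*=(x)$ and $(xA)^*=xA^*$; $A\subseteq A^*$, and $A\subseteq B$ implies $A^*\subseteq B^*$; $(A^* )^*=A^*$. It is of finite type if $*=*_f$, where $A^{*_f}=\bigcup\{B^*\mid B\subseteq A,\ B$ a nonzero finitely generated homogeneous fractional ideal$\}$ for $A\in\mathbf{HF}(R)$. $\mathrm{HStar}(R)$ is the set of homogeneous star operations on $R$; its Zariski topology has as subbasic open sets the sets $W_A=\{*\in\mathrm{HStar}(R)\mid 1\in A^*\}$, $A\in\mathbf{HF}(R)$. $\mathrm{HStar}_f(R)$,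 the subset of finite type operations, carries the subspace topology (also called the Zariski topology). A topological space is spectral if it is quasi-compact and $T_0$, its quasi-compact open subsets are closed under finite intersection and form a basis, and every nonempty irreducible closed subset is the closure of a unique point. *)

(* Defs.v *)
From HB Require Import structures.
From mathcomp Require Import all_boot all_order all_algebra generic_quotient.
From mathcomp Require Import all_classical.
From mathcomp Require Import topology.

Set Implicit Arguments.
Unset Strict Implicit.
Unset Printing Implicit Defensive.

Import GRing.Theory.

Local Open Scope classical_set_scope.
Local Open Scope quotient_scope.
Local Open Scope ring_scope.

(* Commutative monoids are written additively, as [nmodType]s. *)

Section QuotientGroup.
Variable M : nmodType.

(* The pair (a, b) stands for the formal difference a - b. The extra k makes
   this an equivalence relation on every commutative monoid; it can be
   cancelled when M is cancellative. *)
Definition diff_equiv (p q : M * M) : bool :=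
  `[< exists k : M, p.1 + q.2 + k = q.1 + p.2 + k >].

Lemma diff_equiv_refl : reflexive diff_equiv.
Proof. by move=> p; apply/asboolP; exists 0. Qed.

Lemma diff_equiv_sym : symmetric diff_equiv.
Proof.
by move=> p q; apply/idP/idP => /asboolP[k e]; apply/asboolP; exists k.
Qed.

Lemma diff_equiv_trans : transitive diff_equiv.
Proof.
move=> q p r /asboolP[k e] /asboolP[l f]; apply/asboolP.
exists (q.2 + k + (q.1 + l)).
rewrite [LHS](AC (2*(2*2)) ((1*3*4)*(5*2*6))) /= e f.
by rewrite (AC (3*3) ((4*2)*((5*3)*(1*6)))).
Qed.

Canonical diff_equivRel :=
  EquivRel diff_equiv diff_equiv_refl diff_equiv_sym diff_equiv_trans.

Definition quotient_group := {eq_quot diff_equiv}.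

HB.instance Definition _ : EqQuotient _ diff_equiv quotient_group :=
  EqQuotient.on quotient_group.
HB.instance Definition _ := Choice.on quotient_group.

Definition diff (a b : M) : quotient_group := \pi_quotient_group (a, b).

Lemma diffP (a b c d : M) :
  (exists k, a + d + k = c + b + k) <-> diff a b = diff c d.
Proof.
split=> [h|/eqmodP/asboolP//]; exact/eqmodP/asboolP.
Qed.

Lemma diff_surj (x : quotient_group) : exists a b, x = diff a b.
Proof.
by exists (repr x).1, (repr x).2; rewrite /diff -surjective_pairing reprK.
Qed.

Definition qg_add (x y : quotient_group) : quotient_group :=
  diff ((repr x).1 + (repr y).1) ((repr x).2 + (repr y).2).
Definition qg_opp (x : quotient_group) : quotient_group :=
  diff (repr x).2 (repr x).1.

Lemma repr_diff (a b : M) :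
  exists k, (repr (diff a b)).1 + b + k = a + (repr (diff a b)).2 + k.
Proof.
by apply/diffP; rewrite /diff -surjective_pairing reprK.
Qed.

Lemma qg_addE (a b c d : M) :
  qg_add (diff a b) (diff c d) = diff (a + c) (b + d).
Proof.
apply/diffP; have [k e] := repr_diff a b; have [l f] := repr_diff c d.
exists (k + l).
rewrite [LHS](AC (2*2*2) ((1*3*5)*(2*4*6))) /= e f.
by rewrite (AC (3*3) ((1*4)*(2*5)*(3*6))).
Qed.

Lemma qg_oppE (a b : M) : qg_opp (diff a b) = diff b a.
Proof.
apply/diffP; have [k e] := repr_diff a b; exists k.
by rewrite [X in X + k]addrC -e [X in X + k]addrC.
Qed.

Lemma qg_addA : associative qg_add.
Proof.
move=> x y z; have [a [b ->]] := diff_surj x; have [c [d ->]] := diff_surj y.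
by have [e [f ->]] := diff_surj z; rewrite !qg_addE !addrA.
Qed.

Lemma qg_addC : commutative qg_add.
Proof.
move=> x y; have [a [b ->]] := diff_surj x; have [c [d ->]] := diff_surj y.
by rewrite !qg_addE addrC [b + d]addrC.
Qed.

Lemma qg_add0 : left_id (diff 0 0) qg_add.
Proof. by move=> x; have [a [b ->]] := diff_surj x; rewrite qg_addE !add0r. Qed.

Lemma qg_addN : left_inverse (diff 0 0) qg_opp qg_add.
Proof.
move=> x; have [a [b ->]] := diff_surj x; rewrite qg_oppE qg_addE.
by apply/diffP; exists 0; rewrite !addr0 add0r addrC.
Qed.

HB.instance Definition _ :=
  GRing.isZmodule.Build quotient_group qg_addA qg_addC qg_add0 qg_addN.

End QuotientGroup.

Section Monoid.
Variable M : nmodType.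

Definition cancellative := right_injective (@GRing.add M).

Definition torsion_free (G : zmodType) :=
  forall (g : G) (n : nat), (0 < n)%N -> g *+ n = 0 -> g = 0.

Definition torsionless := torsion_free (quotient_group M).

End Monoid.

(* The set M is the internal direct sum of the family P. *)
Definition is_direct_sum (I : eqType) (V : zmodType)
    (M : set V) (P : I -> set V) :=
  M = [set x | exists (s : seq I) (f : I -> V),
         [/\ uniq s, forall i, i \in s -> P i (f i) & x = \sum_(i <- s) f i]] /\
  (forall (s : seq I) (f : I -> V), uniq s ->
     (forall i, i \in s -> P i (f i)) ->
     \sum_(i <- s) f i = 0 -> forall i, i \in s -> f i = 0).

Definition is_grading (Gam : nmodType) (R : idomainType) (Rg : Gam -> set R) :=
  [/\ forall a, Rg a 0,
      forall a x y, Rg a x -> Rg a y -> Rg a (x - y),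
      forall a b x y, Rg a x -> Rg b y -> Rg (a + b) (x * y) &
      is_direct_sum [set: R] Rg].

Notation "x %:F" := (FracField.tofrac x) : ring_scope.

Section FractionalIdeals.
Variable R : idomainType.
Local Notation K := {fraction R}.

Definition is_ideal (I : set R) :=
  [/\ I 0, forall x y, I x -> I y -> I (x + y) &
      forall r x, I x -> I (r * x)].

Definition is_submodule (A : set K) :=
  [/\ A 0, forall x y, A x -> A y -> A (x + y) &
      forall (r : R) x, A x -> A (r%:F * x)].

Definition scale (x : K) (A : set K) : set K := [set x * a | a in A].

Definition is_fractional_ideal (A : set K) :=
  is_submodule A /\
  exists2 d : R, d != 0 & scale d%:F A `<=` range (@FracField.tofrac R).

Definition principal (x : K) : set K := [set r%:F * x | r in [set: R]].

Definition finitely_generated (A : set K) :=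
  exists (n : nat) (g : 'I_n -> K),
    A = [set \sum_(i < n) (c i)%:F * g i | c in [set: 'I_n -> R]].

End FractionalIdeals.

Section Graded.
Variables (Gam : nmodType) (R : idomainType) (Rg : Gam -> set R).
Local Notation K := {fraction R}.

(* The nonzero homogeneous elements of R. *)
Definition Hset : set R := [set x | x != 0 /\ exists a, Rg a x].

(* The component of degree g of the localization R_H, as a subset of K. *)
Definition RH_piece (g : quotient_group Gam) : set K :=
  [set x | exists (a b : Gam) (r s : R),
     [/\ Rg a r, Rg b s, s != 0, g = diff a b & x = r%:F / s%:F]].

Definition RH_homogeneous (x : K) := exists g, RH_piece g x.

Definition is_homogeneous_ideal (I : set R) :=
  is_ideal I /\ is_direct_sum I (fun a => I `&` Rg a).

Definition is_homogeneous_fractional (A : set K) :=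
  is_fractional_ideal A /\
  exists2 s : R, Hset s &
    exists2 I : set R, is_homogeneous_ideal I &
      scale s%:F A = [set r%:F | r in I].

Record HF := MkHF {
  HF_set :> set K;
  HF_homogeneous : is_homogeneous_fractional HF_set;
  HF_nonzero : exists2 x, HF_set x & x != 0
}.

(* In [hstar1] and [hstarZ], "A is (x)" and "B is xA" are hypotheses because
   elements of [HF] carry proofs; the lemmas [HF_principal] and [HF_scale]
   below show that (x) and xA do belong to [HF]. *)
Record HStar := MkHStar {
  hstar :> HF -> HF;
  hstar1 : forall (x : K) (A : HF), RH_homogeneous x -> x != 0 ->
    A = principal x :> set K -> hstar A = principal x :> set K;
  hstarZ : forall (x : K) (A B : HF), RH_homogeneous x -> x != 0 ->
    B = scale x A :> set K -> hstar B = scale x (hstar A) :> set K;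
  hstar_sub : forall A : HF, A `<=` hstar A;
  hstar_mono : forall A B : HF, A `<=` B -> hstar A `<=` hstar B;
  hstar_idem : forall A : HF, hstar (hstar A) = hstar A
}.

(* The set A^{*_f}. *)
Definition hstar_f (st : HStar) (A : HF) : set K :=
  \bigcup_(B in [set B : HF | B `<=` A /\ finitely_generated B]) (st B : set K).

Definition finite_type (st : HStar) :=
  forall A : HF, st A = hstar_f st A :> set K.

HB.instance Definition _ := gen_eqMixin HStar.
HB.instance Definition _ := gen_choiceMixin HStar.

Definition W (A : HF) : set HStar := [set st : HStar | (st A : set K) 1].

HB.instance Definition _ := isSubBaseTopological.Build HStar (range W) id.

(* Used as a type, a subset of a topological space carries the subspace
   topology. *)
Definition HStar_f : set HStar := [set st | finite_type st].

End Graded.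

Arguments HStar_f {Gam R} Rg _.

Section NonVacuity.
Variables (Gam : nmodType) (R : idomainType) (Rg : Gam -> set R).
Hypotheses (canc : cancellative Gam) (gr : is_grading Rg).
Local Notation K := {fraction R}.

Lemma sum_closed (I : eqType) (J : set R) (s : seq I) (f : I -> R) :
  is_ideal J -> (forall i, i \in s -> J (f i)) -> J (\sum_(i <- s) f i).
Proof.
move=> [J0 JD _] Jf; rewrite big_seq.
by apply: (big_ind J) => // i /Jf.
Qed.

Lemma homogeneous_idealT : is_homogeneous_ideal Rg [set: R].
Proof.
split=> //; case: gr => _ _ _.
by congr is_direct_sum; apply/funext => a; rewrite setTI.
Qed.

Lemma homogeneous_ideal_mull (J : set R) (a : Gam) (r : R) :
  is_homogeneous_ideal Rg J -> Rg a r ->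
  is_homogeneous_ideal Rg [set r * j | j in J].
Proof.
move=> [Jid [Jspan _]] Rr; have [J0 JD JM] := Jid.
have rJid : is_ideal [set r * j | j in J].
  split; first by exists 0; rewrite ?mulr0.
  - by move=> _ _ [x Jx <-] [y Jy <-]; exists (x + y); rewrite ?mulrDr//; exact: JD.
  - by move=> t _ [x Jx <-]; exists (t * x); rewrite 1?mulrCA//; exact: JM.
have [_ _ RM [_ Rindep]] := gr.
split=> //; split; last first.
  by move=> s f us sf; apply: Rindep => // i /sf[].
apply/seteqP; split=> [_ [j Jj <-]|_ [s [f [_ sf ->]]]]; last first.
  by apply: sum_closed => // i /sf[].
move: Jj; rewrite {1}Jspan => -[s [f [us sf ->]]].
have inj : injective (+%R a) by exact: canc.
pose g k := r * f (nth 0 s (index k (map (+%R a) s))).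
have gE i : i \in s -> g (a + i) = r * f i.
  by move=> si; rewrite /g index_map// nth_index.
exists (map (+%R a) s), g; split; first by rewrite map_inj_uniq.
  move=> _ /mapP[i si ->]; rewrite gE//; have [Jf Rf] := sf _ si.
  by split; [exists (f i)|exact: RM].
by rewrite big_map mulr_sumr; apply: eq_big_seq => i /gE.
Qed.

Lemma tofrac_neq0 (r : R) : r != 0 -> r%:F != 0.
Proof. by rewrite tofrac_eq0. Qed.

Lemma HF_principal (x : K) : RH_homogeneous Rg x -> x != 0 ->
  exists A : HF Rg, A = principal x :> set K.
Proof.
move=> [g [a [b [r [s [Rr Rs s0 _ xE]]]]]] x0.
have sx : s%:F * x = r%:F by rewrite xE mulrCA mulfV ?mulr1 ?tofrac_neq0.
suff [P1 P2] : is_homogeneous_fractional Rg (principal x) /\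
    exists2 y, principal x y & y != 0 by exists (MkHF P1 P2).
split; last by exists x => //; exists 1 => //; rewrite tofrac1 mul1r.
split.
  split; last first.
    by exists s => // _ [_ [t _ <-] <-]; exists (t * r); rewrite // mulrCA sx tofracM.
  split; first by exists 0 => //; rewrite tofrac0 mul0r.
  - move=> _ _ [t _ <-] [u _ <-]; exists (t + u) => //.
    by rewrite tofracD mulrDl.
  - by move=> t _ [u _ <-]; exists (t * u) => //; rewrite tofracM mulrA.
exists s; first by split=> //; exists b.
exists [set r * j | j in [set: R]].
  exact: homogeneous_ideal_mull homogeneous_idealT Rr.
apply/seteqP; split=> [_ [_ [t _ <-] <-]|_ [_ [t _ <-] <-]].
  by exists (r * t); [exists t|rewrite mulrCA sx mulrC tofracM].
exists (t%:F * x); first by exists t.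
by rewrite mulrCA sx mulrC tofracM.
Qed.

Lemma HF_scale (x : K) (A : HF Rg) : RH_homogeneous Rg x -> x != 0 ->
  exists B : HF Rg, B = scale x A :> set K.
Proof.
move=> [g [a [b [r [s [Rr Rs s0 _ xE]]]]]] x0.
have sx : s%:F * x = r%:F by rewrite xE mulrCA mulfV ?mulr1 ?tofrac_neq0.
have [[[[A0 AD AM] [d d0 Ad]] [t [t0 [c Rt]] [J Jh AJ]]] [y Ay y0]] :=
  (HF_homogeneous A, HF_nonzero A).
suff [P1 P2] : is_homogeneous_fractional Rg (scale x A) /\
    exists2 z, scale x A z & z != 0 by exists (MkHF P1 P2).
split; last by exists (x * y); [exists y|rewrite mulf_neq0].
split.
  split; last first.
    exists (d * s); first by rewrite mulf_neq0.
    move=> _ [_ [z Az <-] <-].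
    have [|u _ uE] := Ad (d%:F * z); first by exists z.
    exists (r * u) => //.
    by rewrite !tofracM uE -sx mulrACA mulrA [s%:F * d%:F]mulrC !mulrA.
  split; first by exists 0; rewrite ?mulr0.
  - move=> _ _ [z Az <-] [w Aw <-]; exists (z + w); last by rewrite mulrDr.
    exact: AD.
  - move=> u _ [z Az <-]; exists (u%:F * z); last by rewrite mulrCA.
    exact: AM.
exists (t * s).
  split; first by rewrite mulf_neq0.
  by exists (c + b); case: gr => _ _ RM _; exact: RM.
exists [set r * j | j in J]; first exact: homogeneous_ideal_mull Jh Rr.
have tsE z : (t * s)%:F * (x * z) = r%:F * (t%:F * z).
  by rewrite tofracM -sx [t%:F * _]mulrC mulrACA.
apply/seteqP; split=> [_ [_ [z Az <-] <-]|_ [_ [j Jj <-] <-]].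
  have : scale t%:F A (t%:F * z) by exists z.
  rewrite AJ => -[j Jj jE]; exists (r * j); first by exists j.
  by rewrite tsE tofracM jE.
have : [set r%:F | r in J] j%:F by exists j.
rewrite -AJ => -[z Az zE]; exists (x * z); first by exists z.
by rewrite tsE zE tofracM.
Qed.

End NonVacuity.

Section Spectral.
Variable X : topologicalType.

Definition irreducible (C : set X) :=
  C !=set0 /\
  forall E F : set X, closed E -> closed F ->
    C `<=` E `|` F -> C `<=` E \/ C `<=` F.

Definition spectral :=
  [/\ compact [set: X],
      kolmogorov_space X,
      forall U V : set X, open U -> compact U -> open V -> compact V ->
        compact (U `&` V),
      basis [set U : set X | open U /\ compact U] &
      forall C : set X, closed C -> irreducible C ->
        exists! x : X, C = closure [set x]].

End Spectral.

(* Main.v *)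
(* If every ultrafilter F on a T0 space X with subbase S has a point x that lies
   in exactly the members of S belonging to F, then X is spectral: the finite
   intersections of members of S form a basis of compact open sets, and an
   ultrafilter containing an irreducible closed set C and every open set that
   meets C yields the generic point of C.
   For finite type homogeneous star operations the sets W_B with B finitely
   generated form a subbase. The point attached to F sends A to the set of all x
   such that, for some finitely generated B contained in A, F-almost every
   operation * satisfies x \in B^*. *)

Require Import Defs.
From HB Require Import structures.
From mathcomp Require Import all_boot all_order all_algebra finmap.
From mathcomp Require Import all_classical.
From mathcomp Require Import topology.

Set Implicit Arguments.
Unset Strict Implicit.
Unset Printing Implicit Defensive.

Import GRing.Theory.

Local Open Scope classical_set_scope.
Local Open Scope ring_scope.

(** * Spectral spaces from limits of ultrafilters *)

Section SpectralCriterion.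
Variables (X : topologicalType) (S : set (set X)).
Hypotheses (Sbasis : basis (finI_from S id))
  (Ssep : forall x y, (forall U, S U -> U x <-> U y) -> x = y)
  (Slim : forall F : set_system X, UltraFilter F ->
     exists x, forall U, S U -> U x <-> F U).

Lemma subbase_open (U : set X) : S U -> open U.
Proof.
move=> SU; apply: Sbasis.1; exact: (finI_from1 id).
Qed.

Lemma finI_from_ultra_limit (F : set_system X) (x : X) (V : set X) :
  UltraFilter F -> (forall U, S U -> U x <-> F U) -> finI_from S id V ->
  V x <-> F V.
Proof.
move=> FU xF [D DS <-]; split=> [Vx|FV].
  by apply: filter_bigI => U DU; apply/(xF U (set_mem (DS _ DU))); exact: Vx.
move=> U DU; apply/(xF U (set_mem (DS _ DU))).
by apply: filterS FV => y; apply.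
Qed.

Lemma ultra_limit_cvg (F : set_system X) (x : X) : UltraFilter F ->
  (forall U, S U -> U x <-> F U) -> F --> x.
Proof.
move=> FU xF A /(Sbasis.2 x)[V [SV Vx] VA].
exact: filterS VA ((finI_from_ultra_limit FU xF SV).1 Vx).
Qed.

(** Compactness yields a limit [u] of [F] in [U], which may differ from [x]. A basic neighbourhood
    of [u] inside [U] belongs to [F], and therefore contains [x]. *)
Lemma ultra_limit_compact_open (F : set_system X) (x : X) (U : set X) :
  UltraFilter F -> (forall V, S V -> V x <-> F V) ->
  open U -> compact U -> F U -> U x.
Proof.
move=> FU xF Uo; rewrite compact_ultra => Uc FFU.
have [u [Uu Fu]] := Uc F FU FFU.
have /(Sbasis.2 u)[V [SV Vu] VU] : nbhs u U by exact: open_nbhs_nbhs.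
apply/VU/(finI_from_ultra_limit FU xF SV)/Fu.
by apply: open_nbhs_nbhs; split=> //; exact: Sbasis.1.
Qed.

Lemma finI_from_compact (V : set X) : finI_from S id V -> compact V.
Proof.
move=> SV; rewrite compact_ultra => F FU FV; have [x xF] := Slim FU.
exists x; split; first exact/(finI_from_ultra_limit FU xF SV).
exact: ultra_limit_cvg.
Qed.

(** By irreducibility, two open sets that meet [C] have an intersection that meets [C]. Their traces
    on [C] thus generate a proper filter, which an ultrafilter refines. *)
Lemma irreducible_ultra (C : set X) : irreducible C ->
  exists F : set_system X, [/\ UltraFilter F, F C &
    forall U, open U -> U `&` C !=set0 -> F U].
Proof.
move=> [[c Cc] Cirr].
pose B := [set U : set X | open U /\ U `&` C !=set0].
pose G : set_system X := filter_from B (setI^~ C).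
have BT : B setT by split; [exact: openT|exists c].
have PG : ProperFilter G.
  apply: filter_from_proper => [|U [_ //]].
  apply: filter_from_filter; first by exists setT.
  move=> U V [Uo [u [Uu Cu]]] [Vo [v [Vv Cv]]].
  exists (U `&` V); last by move=> x [[]].
  split; first exact: openI.
  apply: contrapT => UVC.
  have [|CU|CV] := Cirr (~` U) (~` V) (open_closedC Uo) (open_closedC Vo).
  - move=> x Cx; apply: contrapT => /not_orP[/contrapT Ux /contrapT Vx].
    by apply: UVC; exists x.
  - exact: CU Uu.
  - exact: CV Vv.
have [F [FU GF]] := ultraFilterLemma PG; exists F; split=> //.
  by apply: GF; exists setT => // x [].
by move=> U Uo UC; apply: GF; exists U => // x [].
Qed.

Lemma closure1_eq (x y : X) : closure [set x] = closure [set y] -> x = y.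
Proof.
suff cl (z t : X) : closure [set t] z -> forall U, S U -> U z -> U t.
  move=> xy; apply: Ssep => U SU; split; apply: cl => //.
    by rewrite -xy; exact: subset_closure.
  by rewrite xy; exact: subset_closure.
move=> clz U SU Uz; have [|_ [-> //]] := clz U.
by apply: open_nbhs_nbhs; split=> //; exact: subbase_open.
Qed.

Lemma spectral_of_ultra_limits : spectral X.
Proof.
split.
(* The whole space is the empty intersection of members of [S]. *)
- apply: finI_from_compact; exists fset0%fset => //.
  by rewrite set_fset0 bigcap_set0.
- move=> x y; apply: contra_neqP => /forallNP h; apply: Ssep => U SU.
  have nU z : U z -> U \in nbhs z.
    move=> Uz; apply/mem_set/open_nbhs_nbhs; split=> //; exact: subbase_open.
  split=> Uz; apply: contrapT => nUz; apply: (h U); [left|right].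
    by split; [exact: nU|exact/mem_set].
  by split; [exact: nU|exact/mem_set].
- move=> U V Uo Uc Vo Vc; rewrite compact_ultra => F FU FUV.
  have [x xF] := Slim FU; exists x; split; last exact: ultra_limit_cvg.
  split; apply: ultra_limit_compact_open xF _ _ _ => //.
    by apply: filterS FUV => y [].
  by apply: filterS FUV => y [].
- split=> [U []//|x A /(Sbasis.2 x)[V [SV Vx] VA]].
  exists V => //; split=> //; split; first exact: Sbasis.1.
  exact: finI_from_compact.
- move=> C Ccl Cirr; have [F [FU FC FO]] := irreducible_ultra Cirr.
  have [x xF] := Slim FU.
  have Cx : C x by exact: closed_cvg (ultra_limit_cvg FU xF).
  (* Every basic neighbourhood of a point of [C] meets [C], so it belongs to [F] and contains
     [x]. *)
  have CE : C = closure [set x].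
    apply/seteqP; split=> [c Cc A /(Sbasis.2 c)[V [SV Vc] VA]|].
      exists x; split=> //; apply: VA; apply/(finI_from_ultra_limit FU xF SV).
      by apply: FO; [exact: Sbasis.1|exists c].
    by rewrite [X in _ `<=` X](closure_id _).1//; apply: closure_subset => _ ->.
  by exists x; split=> // y Cy; apply: closure1_eq; rewrite -CE.
Qed.

End SpectralCriterion.

(** * Homogeneous components and homogeneous fractional ideals *)

Section Components.
Variables (Gam : nmodType) (R : idomainType) (Rg : Gam -> set R).
Hypotheses (canc : cancellative Gam) (gr : is_grading Rg).

(** A decomposition is a function on all degrees with finite support, so that subtraction is
    pointwise and uniqueness is an equality of functions. *)
Definition is_decomp (r : R) (f : Gam -> R) :=
  (forall a, Rg a (f a)) /\
  exists2 s : seq Gam, uniq s /\ (forall a, a \notin s -> f a = 0) &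
    r = \sum_(a <- s) f a.

Lemma decomp_exists (r : R) : exists f, is_decomp r f.
Proof.
have [Rg0 _ _ [RT _]] := gr.
have : [set: R] r by [].
rewrite RT => -[s [f [us sf ->]]].
exists (fun a => if a \in s then f a else 0); split.
  by move=> a; case: ifP => [/sf//|_]; exact: Rg0.
exists s; first by split=> // a /negbTE ->.
by apply: eq_big_seq => a ->.
Qed.

Definition component (r : R) : Gam -> R := sval (cid (decomp_exists r)).

Lemma componentP (r : R) : is_decomp r (component r).
Proof. exact: svalP (cid (decomp_exists r)). Qed.

Lemma sum_decomp_widen (f : Gam -> R) (s t : seq Gam) : uniq s -> uniq t ->
  (forall a, a \notin s -> f a = 0) -> {subset s <= t} ->
  \sum_(a <- s) f a = \sum_(a <- t) f a.
Proof.
move=> us ut f0 st; rewrite [RHS](bigID (mem s)) /= [X in _ + X]big1 ?addr0.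
  rewrite -[RHS]big_filter; apply: perm_big; apply: uniq_perm => //.
    exact: filter_uniq.
  by move=> a; rewrite mem_filter /=; case: (boolP (a \in s)) => // /st.
by move=> a /f0.
Qed.

Lemma decomp_sub (r t : R) (f g : Gam -> R) :
  is_decomp r f -> is_decomp t g -> is_decomp (r - t) (fun a => f a - g a).
Proof.
have [_ RgB _ _] := gr.
move=> [Rf [s [us f0] ->]] [Rf' [s' [us' g0] ->]]; split.
  by move=> a; exact: RgB.
exists (undup (s ++ s')).
  split=> [|a]; first exact: undup_uniq.
  by rewrite mem_undup mem_cat => /norP[/f0 -> /g0 ->]; rewrite subr0.
have ut := undup_uniq (s ++ s').
rewrite sumrB; congr (_ - _); apply: sum_decomp_widen => // a sa.
  by rewrite mem_undup mem_cat sa.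
by rewrite mem_undup mem_cat sa orbT.
Qed.

Lemma decomp_eq0 (f : Gam -> R) : is_decomp 0 f -> f =1 fun=> 0.
Proof.
have [_ _ _ [_ Rindep]] := gr.
move=> [Rf [s [us f0] sum0]] a; have [sa|/f0//] := boolP (a \in s).
exact: Rindep us _ (esym sum0) _ sa.
Qed.

Lemma decomp_uniq (r : R) (f : Gam -> R) : is_decomp r f -> component r =1 f.
Proof.
move=> /(decomp_sub (componentP r)); rewrite subrr => /decomp_eq0 f0 a.
exact/subr0_eq/f0.
Qed.

Lemma componentB (r t : R) (a : Gam) :
  component (r - t) a = component r a - component t a.
Proof. exact: decomp_uniq (decomp_sub (componentP r) (componentP t)) a. Qed.

Lemma componentD (r t : R) (a : Gam) :
  component (r + t) a = component r a + component t a.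
Proof.
have c0 b : component 0 b = 0 by exact: decomp_eq0 (componentP 0) b.
by rewrite -{1}[t]opprK componentB -[- t]sub0r componentB c0 sub0r opprK.
Qed.

(** Translation by [b] is injective by cancellativity, so the translated products are a
    decomposition of [s * r], and decompositions are unique. As [Gam] is only a monoid, the degrees
    outside [b + Gam] form a separate case. *)
Lemma componentM_cases (b : Gam) (s r : R) : Rg b s ->
  (forall a, component (s * r) (b + a) = s * component r a) /\
  (forall c, ~ (exists a, c = b + a) -> component (s * r) c = 0).
Proof.
have [Rg0 _ RgM _] := gr; move=> Rs.
have inj : injective (+%R b) by exact: canc.
(* The degree [a] picked by choice is the only one with [c = b + a]. *)
pose g c := if pselect (exists a, c = b + a) is left e
            then s * component r (sval (cid e)) else 0.
have gE a : g (b + a) = s * component r a.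
  rewrite /g; case: pselect => [e|]; last by case; exists a.
  by case: (cid e) => /= a' /inj ->.
have g0 c : ~ (exists a, c = b + a) -> g c = 0 by rewrite /g; case: pselect.
suff /decomp_uniq gP : is_decomp (s * r) g.
  by split=> [a|c /g0]; rewrite gP.
have [Rf [t [ut f0] rE]] := componentP r; split=> [c|].
  have [[a ->]|/g0 -> //] := pselect (exists a, c = b + a).
  by rewrite gE; exact: RgM.
exists (map (+%R b) t).
  split=> [|c tc]; first by rewrite map_inj_uniq.
  have [[a ca]|/g0 -> //] := pselect (exists a, c = b + a).
  rewrite ca gE f0 ?mulr0//; apply: contraNN tc => ta.
  by rewrite ca; exact: map_f.
by rewrite big_map {1}rE mulr_sumr; exact: eq_bigr.
Qed.

(** Any decomposition of [r] inside [I] consists of its components, by uniqueness; independence of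
    the summands is inherited from the grading of [R]. *)
Lemma homogeneous_idealP (I : set R) : is_ideal I ->
  is_homogeneous_ideal Rg I <-> forall r a, I r -> I (component r a).
Proof.
have [Rg0 _ _ [_ Rindep]] := gr.
move=> Iid; have [I0 _ _] := Iid; split=> [[_ [Ispan _]] r a|Icomp].
  rewrite {1}Ispan => -[s [f [us sf rE]]].
  have /decomp_uniq -> : is_decomp r (fun a => if a \in s then f a else 0).
    split=> [b|]; first by case: ifP => [/sf[]//|_]; exact: Rg0.
    exists s; first by split=> // b /negbTE ->.
    by rewrite rE; apply: eq_big_seq => b ->.
  by case: ifP => [/sf[]|].
split=> //; split; last by move=> s f us sf; apply: Rindep => // i /sf[].
apply/seteqP; split=> [r Ir|_ [s [f [_ sf ->]]]]; last first.
  by apply: sum_closed => // i /sf[].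
have [Rf [s [us _] rE]] := componentP r.
exists s, (component r); split=> // a _.
by split; [exact: Icomp|exact: Rf].
Qed.

(** * Homogeneous fractional ideals: denominators, sums, finitely generated subideals *)

Local Notation K := {fraction R}.
Local Notation HF := (HF Rg).

(* When s A is contained in R, this says that the ideal s A is homogeneous. Unlike
   the s of is_homogeneous_fractional, s may then be any homogeneous denominator
   of A, so that two ideals can be given a common one. *)
Definition component_closed (s : R) (A : set K) :=
  forall r a, A (r%:F / s%:F) -> A ((component r a)%:F / s%:F).

Lemma tofrac_inj : injective (@FracField.tofrac R).
Proof. by move=> x y /eqP; rewrite tofrac_eq => /eqP. Qed.

(** An element with numerator [r] over [t] has a numerator [u] over [s], and [t * u = s * r].
    Comparing the parts of degree [b + a] matches the component of [r] in degree [a] with a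
    component of [u]. *)
Lemma component_closed_change (s t : R) (A : set K) : is_submodule A ->
  Hset Rg s -> Hset Rg t -> scale s%:F A `<=` range (@FracField.tofrac R) ->
  component_closed s A -> component_closed t A.
Proof.
move=> [A0 _ _] [s0 [b Rs]] [t0 [c Rt]] sA Acl r a Ar.
have sF : s%:F != 0 by rewrite tofrac_eq0.
have tF : t%:F != 0 by rewrite tofrac_eq0.
have [|u _ uE] := sA (s%:F * (r%:F / t%:F)); first by exists (r%:F / t%:F).
have us : u%:F / s%:F = r%:F / t%:F by rewrite uE mulrC mulKf.
have tu : t * u = s * r.
  by apply: tofrac_inj; rewrite !tofracM uE mulrCA [t%:F * _]mulrC divfK.
have := (componentM_cases r Rs).1 a; rewrite -tu.
(* If [b + a] is not of the form [c + d], then [t * u] has no part in that degree and the component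
   of [r] vanishes. *)
have [[d ->]|nd] := pselect (exists d, b + a = c + d); last first.
  rewrite (componentM_cases u Rt).2// => /esym/eqP.
  by rewrite mulf_eq0 (negbTE s0) => /eqP ->; rewrite tofrac0 mul0r.
rewrite (componentM_cases u Rt).1 => /(congr1 (@FracField.tofrac R)).
rewrite !tofracM => e.
suff -> : (component r a)%:F / t%:F = (component u d)%:F / s%:F.
  by apply: Acl; rewrite us.
apply: (mulfI sF); rewrite mulrA -e [LHS]mulrC mulKf//.
by rewrite [RHS]mulrC divfK.
Qed.

Lemma HF_eq (A B : HF) : A = B :> set K -> A = B.
Proof.
case: A B => [A Ah An] [B Bh Bn] /= AB; case: _ / AB in Bh Bn *.
by congr MkHF; exact: Prop_irrelevance.
Qed.

Lemma HF_submodule (A : HF) : is_submodule A.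
Proof. by case: (HF_homogeneous A) => [[]]. Qed.

Lemma HF_denominator (A : HF) : exists2 s, Hset Rg s &
  scale s%:F A `<=` range (@FracField.tofrac R).
Proof.
case: (HF_homogeneous A) => _ [s Hs [I _ sA]]; exists s => //.
by rewrite sA; exact: image_subset.
Qed.

Lemma HF_component_closed (A : HF) (s : R) : Hset Rg s ->
  scale s%:F A `<=` range (@FracField.tofrac R) -> component_closed s A.
Proof.
case: (HF_homogeneous A) => _ [t Ht [I Ih tA]] Hs _.
apply: (component_closed_change (HF_submodule A) Ht Hs).
  by rewrite tA; exact: image_subset.
have tF : t%:F != 0 by rewrite tofrac_eq0; case: Ht.
have [Iid _] := Ih.
move=> r a Ar; have : scale t%:F A r%:F.
  by exists (r%:F / t%:F) => //; rewrite mulrC divfK.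
rewrite tA => -[r' Ir' /tofrac_inj rr']; rewrite {}rr' in Ir'.
have : [set r%:F | r in I] (component r a)%:F.
  by exists (component r a) => //; exact: (homogeneous_idealP Iid).1.
by rewrite -tA => -[y Ay <-]; rewrite mulrC mulKf.
Qed.

(** The ideal required by [is_homogeneous_fractional] is [s A] itself, read inside [R]; component
    closure makes it homogeneous. *)
Lemma HF_build (A : set K) (s : R) : is_submodule A -> Hset Rg s ->
  scale s%:F A `<=` range (@FracField.tofrac R) -> component_closed s A ->
  (exists2 x, A x & x != 0) -> exists B : HF, B = A :> set K.
Proof.
move=> Asub Hs sA Acl An; have [s0 _] := Hs; have [A0 AD AM] := Asub.
have sF : s%:F != 0 by rewrite tofrac_eq0.
suff Ah : is_homogeneous_fractional Rg A by exists (MkHF Ah An).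
split; first by split=> //; exists s.
exists s => //; exists [set r | A (r%:F / s%:F)].
  have Iid : is_ideal [set r | A (r%:F / s%:F)].
    split=> [|x y|r x] /=; first by rewrite tofrac0 mul0r.
      by rewrite tofracD mulrDl; exact: AD.
    by rewrite tofracM -mulrA; exact: AM.
  exact/(homogeneous_idealP Iid).
apply/seteqP; split=> [x sAx|_ [r Ar <-]]; last first.
  by exists (r%:F / s%:F) => //; rewrite mulrC divfK.
have [r _ rx] := sA _ sAx; exists r => //=; rewrite rx.
by case: sAx => y Ay <-; rewrite mulrC mulKf.
Qed.

Lemma RH_homogeneous_div (a b : Gam) (r s : R) :
  Rg a r -> Rg b s -> s != 0 -> RH_homogeneous Rg (r%:F / s%:F).
Proof. by move=> Rr Rs s0; exists (diff a b), a, b, r, s. Qed.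

Lemma RH_homogeneousV (x : K) :
  RH_homogeneous Rg x -> x != 0 -> RH_homogeneous Rg x^-1.
Proof.
move=> [g [a [b [r [s [Rr Rs s0 _ ->]]]]]].
rewrite mulf_eq0 tofrac_eq0 negb_or invf_div => /andP[r0 _].
exact: RH_homogeneous_div Rs Rr r0.
Qed.

(** With a homogeneous denominator [s], each element of [A] is the sum of the components of its
    numerator divided by [s], and these lie in [A]. This serves as an induction principle on
    homogeneous elements. *)
Lemma HF_sum_homogeneous (A : HF) (P : set K) : P 0 ->
  (forall x y, P x -> P y -> P (x + y)) ->
  (forall x, HF_set A x -> RH_homogeneous Rg x -> x != 0 -> P x) -> A `<=` P.
Proof.
move=> P0 PD Ph x Ax; have [s Hs sA] := HF_denominator A.
have Acl := HF_component_closed Hs sA; have [s0 [b Rs]] := Hs.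
have sF : s%:F != 0 by rewrite tofrac_eq0.
have [|r _ rE] := sA (s%:F * x); first by exists x.
have xE : x = r%:F / s%:F by rewrite rE mulrC mulKf.
have [Rr [t _ rsum]] := componentP r.
rewrite xE rsum rmorph_sum mulr_suml; apply: (big_ind P) => // a _.
have [-> //|c0] := eqVneq ((component r a)%:F / s%:F) 0.
apply: Ph => //; first by apply: Acl; rewrite -xE.
exact: RH_homogeneous_div (Rr a) Rs s0.
Qed.

(** [C] is the ideal sum, known to later proofs only as a least upper bound that preserves finite
    generation. *)
Lemma HF_add (A B : HF) : exists C : HF, [/\ A `<=` C, B `<=` C,
  (forall D : HF, A `<=` D -> B `<=` D -> C `<=` D) &
  finitely_generated A -> finitely_generated B -> finitely_generated C].
Proof.
have [[A0 AD AM] [B0 BD BM]] := (HF_submodule A, HF_submodule B).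
have [s Hs sA] := HF_denominator A; have [t Ht tB] := HF_denominator B.
have [[s0 [a Rs]] [t0 [b Rt]]] := (Hs, Ht).
pose S : set K := [set x | exists y z, [/\ HF_set A y, HF_set B z & x = y + z]].
have AS : A `<=` S by move=> x Ax; exists x, 0; split=> //; rewrite addr0.
have BS : B `<=` S by move=> x Bx; exists 0, x; split=> //; rewrite add0r.
have Ssub : is_submodule S.
  split; first by exists 0, 0; rewrite addr0.
  - move=> _ _ [y [z [Ay Bz ->]]] [y' [z' [Ay' Bz' ->]]].
    exists (y + y'), (z + z'); rewrite addrACA; split=> //.
      exact: AD.
    exact: BD.
  - move=> r _ [y [z [Ay Bz ->]]]; exists (r%:F * y), (r%:F * z).
    by rewrite mulrDr; split=> //; [exact: AM|exact: BM].
(* The product [s * t] is a common homogeneous denominator. *)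
have Hst : Hset Rg (s * t).
  by split; [rewrite mulf_neq0|exists (a + b); case: gr => _ _ + _; apply].
have stA : scale (s * t)%:F A `<=` range (@FracField.tofrac R).
  move=> _ [x Ax <-]; have [|r _ rE] := sA (s%:F * x); first by exists x.
  by exists (t * r) => //; rewrite !tofracM rE mulrCA mulrA.
have stB : scale (s * t)%:F B `<=` range (@FracField.tofrac R).
  move=> _ [x Bx <-]; have [|r _ rE] := tB (t%:F * x); first by exists x.
  by exists (s * r) => //; rewrite !tofracM rE mulrA.
have stF : (s * t)%:F != 0 by rewrite tofrac_eq0; case: Hst.
have divE x r : r%:F = (s * t)%:F * x -> x = r%:F / (s * t)%:F.
  by move=> ->; rewrite mulrC mulKf.
have [|||C CS] := HF_build Ssub Hst.
- move=> _ [_ [y [z [Ay Bz ->]]] <-].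
  have [|r _ rE] := stA ((s * t)%:F * y); first by exists y.
  have [|u _ uE] := stB ((s * t)%:F * z); first by exists z.
  by exists (r + u) => //; rewrite tofracD rE uE mulrDr.
- move=> r c [y [z [Ay Bz yz]]].
  have [|u _ uE] := stA ((s * t)%:F * y); first by exists y.
  have [|v _ vE] := stB ((s * t)%:F * z); first by exists z.
  have -> : r = u + v.
    by apply: tofrac_inj; rewrite tofracD uE vE -mulrDr -yz mulrC divfK.
  exists ((component u c)%:F / (s * t)%:F), ((component v c)%:F / (s * t)%:F).
  rewrite componentD tofracD mulrDl; split=> //.
    by apply: (HF_component_closed Hst stA); rewrite -(divE y).
  by apply: (HF_component_closed Hst stB); rewrite -(divE z).
- by case: (HF_nonzero A) => x Ax x0; exists x => //; exact: AS.
exists C; rewrite CS; split=> //.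
  move=> D AsD BsD _ [y [z [Ay Bz ->]]]; have [_ DD _] := HF_submodule D.
  by apply: DD; [exact: AsD|exact: BsD].
move=> [n [g Ag]] [m [h Bh]]; exists (n + m)%N.
exists (fun i : 'I_(n + m)%N =>
  match fintype.split i with inl j => g j | inr k => h k end).
apply/seteqP; split=> [_ [y [z [Ay Bz ->]]]|_ [c _ <-]].
  move: Ay Bz; rewrite Ag Bh => -[c _ <-] [d _ <-].
  exists (fun i : 'I_(n + m)%N =>
    match fintype.split i with inl j => c j | inr k => d k end) => //.
  rewrite big_split_ord /=; congr (_ + _); apply: eq_bigr => i _.
    by rewrite -/(unsplit (inl i)) unsplitK.
  by rewrite -/(unsplit (inr i)) unsplitK.
rewrite big_split_ord /=.
exists (\sum_(i < n) (c (lshift m i))%:F * g i).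
exists (\sum_(i < m) (c (rshift n i))%:F * h i); split.
- by rewrite Ag; exists (fun i => c (lshift m i)).
- by rewrite Bh; exists (fun i => c (rshift n i)).
congr (_ + _); apply: eq_bigr => i _.
  by rewrite -/(unsplit (inl i)) unsplitK.
by rewrite -/(unsplit (inr i)) unsplitK.
Qed.

Lemma principal_fg (x : K) : finitely_generated (principal x).
Proof.
exists 1%N, (fun=> x); apply/seteqP; split=> [_ [r _ <-]|_ [c _ <-]].
  by exists (fun=> r) => //; rewrite big_ord1.
by rewrite big_ord1; exists (c ord0).
Qed.

(** The principal ideal of [x] need not be homogeneous. For homogeneous nonzero [x] it does belong
    to [HF], and [HF_add] handles sums of such elements. *)
Lemma HF_fg_mem (A : HF) (x : K) : HF_set A x ->
  exists B : HF, [/\ finitely_generated B, B `<=` A & HF_set B x].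
Proof.
have Ph y : HF_set A y -> RH_homogeneous Rg y -> y != 0 ->
    exists B : HF, [/\ finitely_generated B, B `<=` A & HF_set B y].
  move=> Ay hy y0; have [B BE] := HF_principal canc gr hy y0.
  exists B; rewrite BE; split; first exact: principal_fg.
    by move=> _ [r _ <-]; have [_ _ AM] := HF_submodule A; exact: AM.
  by exists 1 => //; rewrite tofrac1 mul1r.
(* Members of [HF] are nonzero, so the case [x = 0] needs some [B0]. Without one, [A] would have no
   nonzero homogeneous element and would be zero. *)
have [B0 [B0fg B0A]] : exists B : HF, finitely_generated B /\ B `<=` A.
  apply: contrapT => nB; have [y Ay /eqP[]] := HF_nonzero A; move: y Ay.
  apply: HF_sum_homogeneous => // [y z -> ->|y Ay hy y0]; first by rewrite addr0.
  by case: nB; have [B [Bfg BA _]] := Ph y Ay hy y0; exists B.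
move: x; apply: HF_sum_homogeneous => //.
  by exists B0; split=> //; have [] := HF_submodule B0.
move=> y z [B [Bfg BA By]] [C [Cfg CA Cz]].
have [D [BD CD Dmin Dfg]] := HF_add B C; exists D; split.
- exact: Dfg.
- exact: Dmin.
- by have [_ DD _] := HF_submodule D; apply: DD; [exact: BD|exact: CD].
Qed.

Lemma HF_scaleP (x : K) (A : HF) : RH_homogeneous Rg x -> x != 0 ->
  exists B : HF, B = scale x A :> set K /\
    (finitely_generated A -> finitely_generated B).
Proof.
move=> hx x0; have [B BE] := HF_scale canc gr A hx x0; exists B; split=> //.
rewrite BE => -[n [g ->]]; exists n, (fun i => x * g i).
apply/seteqP; split=> [_ [_ [c _ <-] <-]|_ [c _ <-]].
  by exists c => //; rewrite mulr_sumr; apply: eq_bigr => i _; rewrite mulrCA.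
exists (\sum_(i < n) (c i)%:F * g i); first by exists c.
by rewrite mulr_sumr; apply: eq_bigr => i _; rewrite mulrCA.
Qed.

End Components.

(** * The limit of a filter of star operations *)

Section StarLimit.
Variables (Gam : nmodType) (R : idomainType) (Rg : Gam -> set R).
Hypotheses (canc : cancellative Gam) (gr : is_grading Rg).
Local Notation K := {fraction R}.
Local Notation HF := (HF Rg).
Local Notation HStar := (HStar Rg).

(** [A] lies in the principal ideal of the inverse of [s], which every star operation fixes. One
    denominator thus serves for all operations at once. *)
Lemma hstar_denominator (st : HStar) (A : HF) (s : R) : Hset Rg s ->
  scale s%:F A `<=` range (@FracField.tofrac R) ->
  scale s%:F (st A) `<=` range (@FracField.tofrac R).
Proof.
move=> [s0 [b Rs]] sA; have sF : s%:F != 0 by rewrite tofrac_eq0.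
have hs : RH_homogeneous Rg s%:F^-1.
  (* This form has a homogeneous numerator without appeal to the degree of [1]. *)
  have -> : s%:F^-1 = s%:F / (s * s)%:F by rewrite tofracM invfM mulVKf.
  have [_ _ RgM _] := gr.
  by apply: RH_homogeneous_div Rs (RgM _ _ _ _ Rs Rs) _; rewrite mulf_neq0.
have sV0 : s%:F^-1 != 0 by rewrite invr_eq0.
have [P PE] := HF_principal canc gr hs sV0.
have AP : A `<=` P.
  move=> x Ax; have [|r _ rE] := sA (s%:F * x); first by exists x.
  by rewrite PE; exists r => //; rewrite rE mulrC mulKf.
move=> _ [x /(hstar_mono AP) + <-]; rewrite (hstar1 st hs sV0 PE).
by move=> [r _ <-]; exists r => //; rewrite mulrCA mulfV ?mulr1.
Qed.

Lemma hstar_mem_scale (st : HStar) (A B : HF) (x : K) :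
  RH_homogeneous Rg x -> x != 0 -> A = scale x B :> set K ->
  HF_set (st A) x <-> HF_set (st B) 1.
Proof.
move=> hx x0 AB; rewrite (hstarZ st hx x0 AB); split=> [[y By]|B1].
  by rewrite -[X in _ = X]mulr1 => /(mulfI x0) <-.
by exists 1 => //; rewrite mulr1.
Qed.

Section Limit.
Variables (F : set_system HStar) (FF : ProperFilter F).

(** [B] is chosen before the operation varies; this uniformity makes the limit of finite type. *)
Definition limit_set (A : HF) : set K :=
  [set x | exists B : HF, [/\ finitely_generated B, B `<=` A &
     F [set st : HStar | HF_set (st B) x]]].

Lemma limit_set_mono (A B : HF) : A `<=` B -> limit_set A `<=` limit_set B.
Proof.
by move=> AB x [C [Cfg CA Cx]]; exists C; split=> //; exact: subset_trans AB.
Qed.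

Lemma sub_limit_set (A : HF) : A `<=` limit_set A.
Proof.
move=> x /(HF_fg_mem canc gr)[B [Bfg BA Bx]]; exists B; split=> //.
by apply: filterS filterT => st _; exact: hstar_sub.
Qed.

Lemma limit_set_submodule (A : HF) : is_submodule (limit_set A).
Proof.
split; first by apply: sub_limit_set; case: (HF_submodule A).
- move=> x y [B [Bfg BA Bx]] [C [Cfg CA Cy]].
  have [D [BD CD Dmin Dfg]] := HF_add canc gr B C.
  exists D; split; [exact: Dfg|exact: Dmin|].
  apply: filterS2 Bx Cy => st Bx Cy; have [_ DD _] := HF_submodule (st D).
  by apply: DD; [exact: hstar_mono BD _ Bx|exact: hstar_mono CD _ Cy].
- move=> r x [B [Bfg BA Bx]]; exists B; split=> //.
  by apply: filterS Bx => st; case: (HF_submodule (st B)) => _ _; apply.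
Qed.

(** A denominator of [A] is one for the closure of every [B] inside [A] under every operation, so
    both integrality and component closure pass to the limit. *)
Lemma limit_set_HF (A : HF) : exists L : HF, L = limit_set A :> set K.
Proof.
have [s Hs sA] := HF_denominator A.
have sB (B : HF) : B `<=` A -> scale s%:F B `<=` range (@FracField.tofrac R).
  by move=> BA; apply: subset_trans sA; exact: image_subset.
apply: (HF_build (gr := gr) (limit_set_submodule A) Hs).
- move=> _ [x [B [_ BA /filter_ex[st Bx]]] <-].
  by apply: (hstar_denominator (st := st) Hs (sB B BA)); exists x.
- move=> r a [B [Bfg BA Br]]; exists B; split=> //.
  apply: filterS Br => st; apply: HF_component_closed => //.
  exact: hstar_denominator (sB B BA).
- by have [x Ax x0] := HF_nonzero A; exists x => //; exact: sub_limit_set.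
Qed.

Definition limit_fun (A : HF) : HF := sval (cid (limit_set_HF A)).

Lemma limit_funE (A : HF) : limit_fun A = limit_set A :> set K.
Proof. exact: svalP (cid (limit_set_HF A)). Qed.

Lemma limit_fun1 (x : K) (A : HF) : RH_homogeneous Rg x -> x != 0 ->
  A = principal x :> set K -> limit_fun A = principal x :> set K.
Proof.
move=> hx x0 Ax; rewrite limit_funE; apply/seteqP; split; last first.
  by rewrite -Ax; exact: sub_limit_set.
move=> y [B [_ BA /filter_ex[st By]]].
by rewrite -(hstar1 st hx x0 Ax); exact: hstar_mono By.
Qed.

Lemma limit_set_scale (x : K) (A B : HF) : RH_homogeneous Rg x -> x != 0 ->
  B = scale x A :> set K -> scale x (limit_set A) `<=` limit_set B.
Proof.
move=> hx x0 BxA _ [y [C [Cfg CA Cy]] <-].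
have [D [DxC Dfg]] := HF_scaleP canc gr C hx x0.
exists D; split; first exact: Dfg.
  by rewrite DxC BxA; exact: image_subset.
by apply: filterS Cy => st Cy; rewrite /= (hstarZ st hx x0 DxC); exists y.
Qed.

Lemma limit_funZ (x : K) (A B : HF) : RH_homogeneous Rg x -> x != 0 ->
  B = scale x A :> set K -> limit_fun B = scale x (limit_fun A) :> set K.
Proof.
move=> hx x0 BxA; rewrite !limit_funE; apply/seteqP; split; last first.
  exact: limit_set_scale.
(* The remaining inclusion is [limit_set_scale] for the inverse of [x]. *)
have AxB : A = scale x^-1 B :> set K.
  rewrite BxA /scale image_comp; apply/seteqP.
  split=> [a Aa|_ [a Aa <-]] /=; last by rewrite mulKf.
  by exists a => //=; rewrite mulKf.
move=> y By; exists (x^-1 * y); last by rewrite mulVKf.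
apply: limit_set_scale AxB _ _; [exact: RH_homogeneousV|by rewrite invr_eq0|].
by exists y.
Qed.

(** The finitely many generators of [B] share one finitely generated [C] inside [A] whose closure
    contains them all for [F]-almost every operation. For these operations [B] lies in the closure
    of [C], hence so does the closure of [B], by idempotence. *)
Lemma limit_fun_idem (A : HF) : limit_fun (limit_fun A) = limit_fun A.
Proof.
apply: HF_eq; rewrite [LHS]limit_funE; apply/seteqP; split; last first.
  exact: sub_limit_set.
move=> x [B [[n [g Bg]] BA Bx]]; rewrite limit_funE.
have Lg i : limit_set A (g i).
  rewrite -limit_funE; apply: BA; rewrite Bg.
  (* The coefficients of a single generator. *)
  exists (fun j => (j == i)%:R) => //.
  rewrite (bigD1 i)//= eqxx tofrac1 mul1r big1 ?addr0// => j /negbTE ->.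
  by rewrite tofrac0 mul0r.
suff [C [Cfg CA Cg]] : exists C : HF, [/\ finitely_generated C, C `<=` A &
    forall i, i \in enum 'I_n -> F [set st : HStar | HF_set (st C) (g i)]].
  exists C; split=> //.
  have {}Cg :
      F (\bigcap_(i in [set: 'I_n]) [set st : HStar | HF_set (st C) (g i)]).
    apply: filterS (filter_forall _ (fun i => Cg i (mem_enum _ i))).
    by move=> st Ci i _; exact: Ci.
  apply: filterS2 Bx Cg => st Bx Cg; rewrite /= -(hstar_idem st C).
  apply: hstar_mono Bx; rewrite Bg => _ [c _ <-].
  have [C0 CD CM] := HF_submodule (st C); apply: big_ind => // i _.
  exact/CM/Cg.
(* The empty list still calls for a finitely generated member of [HF] inside [A]; each further
   generator enlarges [C] by [HF_add]. *)
elim: (enum 'I_n) => [|i e [C [Cfg CA Ce]]].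
  have [x0 /(HF_fg_mem canc gr)[C [Cfg CA _]] _] := HF_nonzero A.
  by exists C.
have [B' [Bfg' BA' Bi]] := Lg i.
have [D [CD BD Dmin Dfg]] := HF_add canc gr C B'.
exists D; split; [exact: Dfg|exact: Dmin|move=> j].
rewrite inE => /orP[/eqP ->|/Ce].
  by apply: filterS Bi => st; exact: hstar_mono.
by apply: filterS => st; exact: hstar_mono.
Qed.

Lemma limit_fun_sub (A : HF) : A `<=` limit_fun A.
Proof. by rewrite limit_funE; exact: sub_limit_set. Qed.

Lemma limit_fun_mono (A B : HF) : A `<=` B -> limit_fun A `<=` limit_fun B.
Proof. by rewrite !limit_funE; exact: limit_set_mono. Qed.

Definition limit_hstar : HStar :=
  MkHStar limit_fun1 limit_funZ limit_fun_sub limit_fun_mono limit_fun_idem.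

(** When [A] is finitely generated, it is itself the best choice of [B]. At [x = 1] this is the
    limit condition on the sets [W A]. *)
Lemma limit_hstar_fg (A : HF) (x : K) : finitely_generated A ->
  HF_set (limit_hstar A) x <-> F [set st : HStar | HF_set (st A) x].
Proof.
move=> Afg; rewrite /= limit_funE.
split=> [[B [_ BA]]|Ax]; last by exists A; split.
by apply: filterS => st; exact: hstar_mono.
Qed.

Lemma limit_hstar_finite : finite_type limit_hstar.
Proof.
move=> A; apply/seteqP; split=> [x|x [B [BA _]]]; last exact: hstar_mono.
rewrite /= limit_funE => -[B [Bfg BA Bx]]; exists B => //.
by rewrite /= limit_funE; exists B; split.
Qed.

End Limit.

(** On [HStar_f], [W A] is thus a union of sets [W B] with [B] finitely generated. *)
Lemma hstar_fg (st : HStar) (A : HF) : finite_type st ->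
  W A st <-> exists B : HF, [/\ finitely_generated B, B `<=` A & W B st].
Proof.
move=> stf; split=> [|[B [_ BA]]]; last exact: hstar_mono.
by rewrite /W /= stf => -[B [BA Bfg] B1]; exists B.
Qed.

(** It suffices to treat homogeneous nonzero [x]; scaling by its inverse turns membership of [x]
    into membership of [1], and finite type descends to a finitely generated ideal. *)
Lemma hstar_le (st st' : HStar) : finite_type st ->
  (forall A : HF, finitely_generated A -> W A st -> W A st') ->
  forall A : HF, st A `<=` st' A.
Proof.
move=> stf W_le A; have [s0 sD _] := HF_submodule (st' A).
apply: (HF_sum_homogeneous canc gr) => // x Ax hx x0.
have xV0 : x^-1 != 0 by rewrite invr_eq0.
have [B [BxA _]] := HF_scaleP canc gr A (RH_homogeneousV hx x0) xV0.
have AxB : A = scale x B :> set K.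
  rewrite BxA /scale image_comp; apply/seteqP.
  split=> [a Aa|_ [a Aa <-]] /=; last by rewrite mulVKf.
  by exists a => //=; rewrite mulVKf.
apply/(hstar_mem_scale st' hx x0 AxB).
have /(hstar_fg B stf)[C [Cfg CB C1]] := (hstar_mem_scale st hx x0 AxB).1 Ax.
exact: hstar_mono CB _ (W_le C Cfg C1).
Qed.

Lemma hstar_eq (st st' : HStar) :
  (forall A : HF, st A = st' A :> set K) -> st = st'.
Proof.
case: st st' => [f a b c d e] [f' a' b' c' d' e'] /= ff'.
have {}ff' : f = f' by apply/funext => A; exact/HF_eq/ff'.
case: _ / ff' in a' b' c' d' e' *.
by congr MkHStar; exact: Prop_irrelevance.
Qed.

End StarLimit.

(** * The Zariski topology *)

Section ZariskiSubbase.
Variables (Gam : nmodType) (R : idomainType) (Rg : Gam -> set R).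
Local Notation X := (HStar_f Rg).

Lemma W_open (A : HF Rg) : open (W A).
Proof.
exists [set W A]; last by rewrite bigcup_set1.
move=> _ ->; exists [fset W A]%fset; last by rewrite set_fset1 bigcap_set1.
by move=> U /fset1P ->; apply/mem_set; exists A.
Qed.

Lemma HStar_open_W (O : set (HStar Rg)) (st : HStar Rg) : open O -> O st ->
  exists2 D : {fset set (HStar Rg)},
    (forall U, U \in D -> U st /\ exists A : HF Rg, U = W A) &
    \bigcap_(U in [set` D]) U `<=` O.
Proof.
move=> [E ED <-] [U EU Ust]; have [D DW DU] := ED _ EU.
exists D; last by rewrite DU => x Ux; exists U.
move=> V DV; split; first by move: Ust; rewrite -DU; apply.
by have /set_mem[A _ <-] := DW _ DV; exists A.
Qed.

Definition W_fg : set (set X) :=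
  [set [set x : X | W A (set_val x)] |
    A in [set A : HF Rg | finitely_generated A]].

Lemma W_fg_basis : basis (finI_from W_fg id).
Proof.
split=> [_ [D DW <-]|x V].
  rewrite bigcap_fset big_seq; apply: big_ind => [||U /DW/set_mem[A _ <-]].
  - exact: openT.
  - exact: openI.
  - by exists (W A) => //; exact: W_open.
rewrite nbhsE => -[_ [[O Oo <-] Ox] OV].
have [D DW DO] := HStar_open_W Oo Ox.
(* The filter generated by the basic sets around [x] allows a finite intersection of sets [W A] to
   be treated one factor at a time. *)
pose B := [set U | finI_from W_fg id U /\ U x].
have FB : Filter (filter_from B id).
  apply: filter_from_filter.
    exists setT; split=> //; exists fset0%fset => //.
    by rewrite set_fset0 bigcap_set0.
  move=> U U' [WU Ux] [WU' Ux']; exists (U `&` U') => //.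
  by split; [exact: finI_fromI|].
apply: filterS OV _; apply: filterS (preimage_subset DO) _.
rewrite preimage_bigcap; apply: filter_bigI => U /DW[Ux [A UA]].
move: Ux; rewrite {U}UA => /(hstar_fg _ (set_mem (valP x)))[C [Cfg CA C1]].
exists [set y : X | W C (set_val y)].
  by split=> //; apply: (finI_from1 id); exists C.
by move=> y; apply: hstar_mono.
Qed.

End ZariskiSubbase.

Theorem theorem3p8 (Gam : nmodType) (R : idomainType) (Rg : Gam -> set R)
  (Gam_neq0 : exists a : Gam, a != 0)
  (Gam_canc : cancellative Gam)
  (Gam_torsionless : torsionless Gam)
  (Rg_grading : is_grading Rg) :
  spectral (HStar_f Rg).
Proof.
apply: (spectral_of_ultra_limits (W_fg_basis Rg)) => [x y xy|F FU].
  have ft (z : HStar_f Rg) : finite_type (set_val z) by exact: set_mem (valP z).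
  have xyW (B : HF Rg) : finitely_generated B ->
      W B (set_val x) <-> W B (set_val y).
    by move=> Bfg; apply: (xy [set z : HStar_f Rg | W B (set_val z)]); exists B.
  apply/val_inj/hstar_eq => A; apply/seteqP; split.
    by apply: (hstar_le Gam_canc Rg_grading (ft x)) => B /xyW[].
  by apply: (hstar_le Gam_canc Rg_grading (ft y)) => B /xyW[].
(* The limit is formed in [HStar] along the image of [F] under the inclusion; being of finite type,
   it is a point of [HStar_f]. *)
pose l := limit_hstar Gam_canc Rg_grading 
  (fmap_proper_filter set_val (ultra_proper (UltraFilter := FU))).
exists (exist _ l (mem_set (limit_hstar_finite _ _ _))) => _ [A Afg <-].
exact: limit_hstar_fg.
Qed.
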